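(* For all integers $k>1$ and $m\ge 1$, with $n=k+m+1$, the reset threshold of the DFA $\mathcal{L}_m^k$ (which has $n$ states) is not less than $\frac{n(n-1)}{2k}$.
   Context: A DFA $\mathcal{A}=(Q,\Sigma)$ consists of finite nonempty sets $Q$ (states) and $\Sigma$ (letters) with a map $Q\times\Sigma\to Q$, $(q,a)\mapsto q\cdot a$, extended to words by $q\cdot\varepsilon=q$, $q\cdot(wa)=(q\cdot w)\cdot a$, and to subsets by $P\cdot w=\{p\cdot w:p\in P\}$. A word $w$ is a reset word for $\mathcal{A}$ if $|Q\cdot w|=1$; the reset threshold of a DFA having reset words is the minimum length of its reset words. The DFA $\mathcal{L}_m^k$: put $n=k+m+1$. The state set is $\{0,1,\dots,n-1\}$ and the input alphabet is $\{a_1,\dots,a_{k+m}\}$. For $i=1,\dots,k$: $i\cdot a_i=0$ and $q\cdot a_i=q$ for $q\neq i$. For $j=1,\dots,m$: $q\cdot a_{k+j}=q+1$ if $j\le q<k+j$; $(k+j)\cdot a_{k+j}=j$; and $q\cdot a_{k+j}=q$ for all other $q$. *)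

(* Defs.v *)
From mathcomp Require Import all_boot.
From mathcomp Require Import zify.
Set Implicit Arguments.
Unset Strict Implicit.
Unset Printing Implicit Defensive.

Record dfa := Dfa {
  state : finType;
  letter : finType;
  step : state -> letter -> state;
  state_nonempty : 0 < #|state|;
  letter_nonempty : 0 < #|letter|
}.

Section Reset.
Variable A : dfa.

Definition run (q : state A) (w : seq (letter A)) : state A :=
  foldl (@step A) q w.

Definition run_set (P : {set state A}) (w : seq (letter A)) : {set state A} :=
  [set run q w | q in P].

Definition reset_word (w : seq (letter A)) : bool :=
  #|run_set [set: state A] w| == 1.

Definition synchronizing : Prop := exists w, reset_word w.

Definition has_reset_word_of_size (l : nat) : bool :=
  [exists w : l.-tuple (letter A), reset_word w].

Lemma synchronizing_size : synchronizing -> exists l, has_reset_word_of_size l.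
Proof.
by case=> w rw; exists (size w); apply/existsP; exists (in_tuple w).
Qed.

Definition reset_threshold (syncA : synchronizing) : nat :=
  ex_minn (synchronizing_size syncA).

End Reset.

(* [L_step k q i] is q . a_i, with letters numbered from 1; for i > k, the
   letter a_i is a_(k+j) with j = i - k. *)
Definition L_step (k q i : nat) : nat :=
  if i <= k then (if q == i then 0 else q)
  else let j := i - k in
    if j <= q < k + j then q.+1
    else if q == k + j then j
    else q.

Lemma L_step_lt (k m : nat) (q : 'I_(k + m + 1)) (i : 'I_(k + m)) :
  L_step k q i.+1 < k + m + 1.
Proof.
rewrite /L_step; have := ltn_ord q; have := ltn_ord i.
by repeat case: ifP => ?; lia.
Qed.

Lemma ord_nonempty (n : nat) : 0 < n -> 0 < #|'I_n|.
Proof. by rewrite card_ord. Qed.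

Lemma L_states_gt0 (k m : nat) : 0 < k + m + 1.
Proof. by rewrite addn1. Qed.

Lemma L_letters_gt0 (k m : nat) : 0 < k -> 0 < k + m.
Proof. by move=> k_gt0; rewrite addn_gt0 k_gt0. Qed.

(* The ordinal i : 'I_(k + m) stands for the letter a_(i+1). *)
Definition L_dfa (k m : nat) (k_gt0 : 0 < k) : dfa :=
  {| state := 'I_(k + m + 1);
     letter := 'I_(k + m);
     step := fun q i => Ordinal (L_step_lt q i);
     state_nonempty := ord_nonempty (L_states_gt0 k m);
     letter_nonempty := ord_nonempty (L_letters_gt0 m k_gt0) |}.

(* Main.v *)
(* The state 0 is a sink, the letter a_i lowers the state i by at most k and
   lowers no other state, and it merges no two states outside the sink.  Hence
   the sum of the elements of a set of states drops by at most k at each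
   letter, while a reset word takes it from n(n-1)/2 down to 0. *)
Require Import Defs.
From mathcomp Require Import all_boot all_order all_algebra.
From mathcomp Require Import zify.
Import Order.TTheory GRing.Theory Num.Theory.
Local Open Scope ring_scope.

Section SinkAutomaton.
Local Open Scope nat_scope.
Variables (A : dfa) (z : state A).
Hypothesis sink : forall a, step z a = z.

Lemma run_cat (q : state A) u v : run q (u ++ v) = run (run q u) v.
Proof. exact: foldl_cat. Qed.

Lemma run_sink w : run z w = z.
Proof. by elim: w => //= a w IHw; rewrite sink. Qed.

Lemma run_set_cons (P : {set state A}) a w :
  run_set P (a :: w) = run_set [set step q a | q in P] w.
Proof. by rewrite /run_set -imset_comp. Qed.

(** Treat the states one by one: once [w] takes those in [s] to [z], append a word taking [run q w]
    to [z]; the earlier states stay in the sink. *)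
Lemma synchronizing_sink : (forall q, exists w, run q w = z) -> synchronizing A.
Proof.
move=> reach.
have [w wP]: exists w, forall q, q \in enum (state A) -> run q w = z.
  elim: (enum _) => [|q s [w IHw]]; first by exists [::].
  have [v qv] := reach (run q w); exists (w ++ v) => p.
  rewrite inE run_cat => /predU1P[-> // | /IHw ->]; exact: run_sink.
exists w; rewrite /reset_word (_ : run_set _ w = [set z]) ?cards1 //.
apply/setP=> p; rewrite inE; apply/imsetP/eqP=> [[q _ ->]|->].
  by rewrite wP ?mem_enum.
by exists z; rewrite ?inE ?run_sink.
Qed.

(** The image always contains [z], since [z] is fixed by every word. *)
Lemma reset_run_set_sink w :
  reset_word w -> run_set [set: state A] w = [set z].
Proof.
move=> /cards1P[p wp]; rewrite wp; congr [set _].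
by apply/esym/set1P; rewrite -wp -[z in z \in _](run_sink w) imset_f.
Qed.

End SinkAutomaton.

Section Descent.
Local Open Scope nat_scope.
Variables (k m : nat) (k_gt0 : 0 < k).
Local Notation L := (L_dfa m k_gt0).

Let zero : state L := Ordinal (L_states_gt0 k m).

Lemma L_sink (a : letter L) : step zero a = zero.
Proof. by apply: val_inj; rewrite /= /L_step; repeat case: ifP => ?; lia. Qed.

(** Every state q > 0 is strictly lowered by the letter a_q, to 0 if q <= k and to q - k otherwise,
    so induction on a bound for q leads to the sink. *)
Lemma L_synchronizing : synchronizing L.
Proof.
apply: (synchronizing_sink _ _ L_sink) => q; move: {2}(val q).+1 (ltnSn q) => b.
elim: b q => // b IHb q leqb; have [q0 | q_gt0] := posnP (val q).
  by exists [::]; apply: val_inj.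
(* Letters are numbered from 1, so a_q is the ordinal q - 1. *)
have lt_q : (val q).-1 < k + m by have := ltn_ord q; move: q_gt0 => /=; lia.
pose a : letter L := Ordinal lt_q.
have lt_qa : val (step q a) < b.
  move: q_gt0 leqb; rewrite /= /L_step => q_gt0 leqb.
  by repeat case: ifP => ?; lia.
by have [w qw] := IHb _ lt_qa; exists (a :: w).
Qed.

Lemma L_step_descent (q : state L) (a : letter L) :
  val q <= val (step q a) + (if val q == a.+1 then k else 0).
Proof. by rewrite /= /L_step; repeat case: ifP => ?; lia. Qed.

(** For i <= k the letter a_i fixes every state but i, which goes to 0; for i = k + j it permutes
    the states, cycling j, ..., k + j. *)
Lemma L_step_inj (a : letter L) :
  {in [pred q | step q a != zero] &, injective (fun q => step q a)}.
Proof.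
move=> p q; rewrite !inE -!val_eqE /= => p0 q0 /(congr1 val) /= pq.
apply: val_inj; move: p0 q0 pq; rewrite /L_step /=.
by repeat case: ifP => ?; lia.
Qed.

Lemma L_sum_step (P : {set state L}) (a : letter L) :
  \sum_(q in P) val q <= \sum_(q in [set step q a | q in P]) val q + k.
Proof.
(* The middle term sums the images with multiplicity; the loss [k] is charged only to the state
   [a.+1], which occurs at most once in [P]. *)
apply: (@leq_trans (\sum_(q in P) val (step q a) + k)).
  apply: leq_trans (leq_sum _ (fun q _ => L_step_descent q a)) _.
  rewrite big_split leq_add2l -big_mkcondr /= sum_nat_const.
  rewrite -[leqRHS]mul1n leq_mul2r; apply/orP; right.
  apply/card_le1_eqP=> p q /andP[_ /eqP pa] /andP[_ /eqP qa].
  exact: val_inj (etrans qa (esym pa)).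
(* States sent to 0 contribute nothing. On the others the letter is injective, so their sum is a sum
   over a subset of the image of [P]. *)
rewrite leq_add2r (bigID (fun q => step q a != zero)) /=.
rewrite [X in _ + X]big1 ?addn0; last first.
  by move=> q /andP[_]; rewrite negbK => /eqP/(congr1 val).
pose P' := [set q in P | step q a != zero].
have injP' : {in P' &, injective (fun q => step q a)}.
  by move=> p q; rewrite !inE => /andP[_ p0] /andP[_ q0]; apply: L_step_inj.
rewrite (eq_bigl [in P']) => [|q]; last by rewrite inE.
rewrite -(big_imset val injP') /=.
apply: (sub_le_big leqnn (fun x y => leq_addr y x)) => p.
by case/imsetP=> q; rewrite inE => /andP[qP _] ->; rewrite imset_f.
Qed.

Lemma L_sum_run_set (P : {set state L}) (w : seq (letter L)) :
  \sum_(q in P) val q <= \sum_(q in run_set P w) val q + size w * k.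
Proof.
elim: w P => [|a w IHw] P; first by rewrite /run_set imset_id addn0.
rewrite run_set_cons [size _ * k]mulSn addnCA [leqRHS]addnC.
by apply: leq_trans (L_sum_step P a) _; rewrite leq_add2r.
Qed.

Lemma L_reset_word_size (w : seq (letter L)) :
  reset_word w -> (k + m + 1) * (k + m) <= 2 * (size w * k).
Proof.
move=> /(reset_run_set_sink _ _ L_sink) wz; have := L_sum_run_set [set: state L] w.
rewrite wz big_set1 add0n; under eq_bigl do rewrite inE.
rewrite -(big_mkord xpredT id) /= => le_sum.
have := bin2_sum (k + m + 1); rewrite bin2 => sumE.
(* The product of two consecutive integers is even, so doubling its half loses nothing. *)
have := odd_double_half ((k + m + 1) * (k + m + 1).-1).
rewrite -sumE addn1 oddM /= andNb add0n => <-.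
by rewrite -mul2n leq_mul2l; move: le_sum; rewrite addn1.
Qed.

End Descent.

Theorem proposition3p12 (k m n : nat) (hk : (1 < k)%N) (hm : (1 <= m)%N)
    (hn : n = (k + m + 1)%N) :
  exists syncL : synchronizing (L_dfa m (ltnW hk)),
    n%:R * (n%:R - 1) / (2 * k%:R) <= (reset_threshold syncL)%:R :> rat.
Proof.
exists (L_synchronizing _ _ _); rewrite /reset_threshold.
(* The threshold is the length of some reset word, to which the bound applies. *)
case: ex_minnP => l /existsP[w /L_reset_word_size]; rewrite size_tuple => le_l _.
have k_gt0 : (0 < k)%N := ltnW hk.
rewrite ler_pdivrMr ?mulr_gt0 ?ltr0n // hn [in X in _ * X]natrD addrK.
by rewrite -!natrM ler_nat mulnCA.
Qed.
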